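(* Let $G=SL(2,\mathbb R)$, $\Gamma=SL(2,\mathbb Z)$, $\pi:G\to G/\Gamma$ the natural projection, and let $\epsilon\in(0,\frac{\pi}{6})$. Write elements of $G$ in the form $g=k_\theta\, n(T)\, a$ with $$k_\theta=\begin{pmatrix}\cos\theta & -\sin\theta\\ \sin\theta & \cos\theta\end{pmatrix}\ (\theta\in\mathbb R/2\pi\mathbb Z,\ \text{represented in }(-\pi,\pi]),\quad n(T)=\begin{pmatrix}1&T\\0&1\end{pmatrix},\quad a=\begin{pmatrix}a&0\\0&a^{-1}\end{pmatrix},\ a>0.$$ Then there is a subset $\mathcal F\subseteq\{k_\theta n(T) a: \theta\in(-\epsilon,\epsilon),\ a\in(0,\infty),\ |T|\le\cot(\epsilon+|\theta|)\}$ that is a fundamental set for $G/\Gamma$, i.e. $\pi|_{\mathcal F}:\mathcal F\to G/\Gamma$ is surjective, injective on the interior of $\mathcal F$, and finite-to-one on the boundary of $\mathcal F$.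
   Context: $\Gamma$ acts on $G$ by right multiplication. The decomposition $g=k_\theta n(T)a$ is the $KNA$ Iwasawa decomposition; it is related to the $KAN$ decomposition $g=k_\theta a n(t)$ by $T=a^2t$. *)

(* Defs.v *)
From HB Require Import structures.
From mathcomp Require Import all_boot all_order all_algebra.
From mathcomp Require Import all_classical all_reals all_analysis.

Set Implicit Arguments.
Unset Strict Implicit.
Unset Printing Implicit Defensive.

Import Order.TTheory GRing.Theory Num.Theory numFieldNormedType.Exports.
Local Open Scope classical_set_scope.
Local Open Scope ring_scope.

Record SL (n : nat) (R : comNzRingType) : Type :=
  mkSL { SL_mx :> 'M[R]_n; SL_det : \det SL_mx == 1 }.

HB.instance Definition _ n R := [isSub for @SL_mx n R].
HB.instance Definition _ n R := [Choice of SL n R by <:].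

Section SLgroup.
Variables (n : nat) (R : comNzRingType).
Implicit Types g h : SL n R.

Fact SL_one_subproof : \det (1%:M : 'M[R]_n) == 1.
Proof. by rewrite det1. Qed.

Fact SL_mul_subproof g h : \det (SL_mx g *m SL_mx h) == 1.
Proof. by rewrite det_mulmx (eqP (SL_det g)) (eqP (SL_det h)) mulr1. Qed.

Fact SL_inv_subproof g : \det (\adj (SL_mx g)) == 1.
Proof.
have := congr1 determinant (mul_mx_adj (SL_mx g)).
by rewrite det_mulmx (eqP (SL_det g)) mul1r det1 => ->.
Qed.

Definition SL_one : SL n R := mkSL SL_one_subproof.
Definition SL_mul g h : SL n R := mkSL (SL_mul_subproof g h).
Definition SL_inv g : SL n R := mkSL (SL_inv_subproof g).

Fact SL_mulA : associative SL_mul.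
Proof. by move=> x y z; apply/val_inj; exact: mulmxA. Qed.
Fact SL_mul1 : left_id SL_one SL_mul.
Proof. by move=> x; apply/val_inj; exact: mul1mx. Qed.
Fact SL_mulr1 : right_id SL_one SL_mul.
Proof. by move=> x; apply/val_inj; exact: mulmx1. Qed.
Fact SL_mulV : left_inverse SL_one SL_inv SL_mul.
Proof.
by move=> x; apply/val_inj; rewrite /= mul_adj_mx (eqP (SL_det x)).
Qed.
Fact SL_mulrV : right_inverse SL_one SL_inv SL_mul.
Proof.
by move=> x; apply/val_inj; rewrite /= mul_mx_adj (eqP (SL_det x)).
Qed.

HB.instance Definition _ := isGroup.Build (SL n R)
  SL_mulA SL_mul1 SL_mulr1 SL_mulV SL_mulrV.

End SLgroup.

HB.instance Definition _ (n : nat) (R : realType) :=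
  Topological.copy (SL n R) (initial_topology (@SL_mx n R)).

Section SLmap.
Variables (n : nat) (R S : comNzRingType) (f : {rmorphism R -> S}).

Fact SL_map_subproof (g : SL n R) : \det (map_mx f g) == 1.
Proof. by rewrite det_map_mx (eqP (SL_det g)) rmorph1. Qed.

Definition SL_map (g : SL n R) : SL n S := mkSL (SL_map_subproof g).

Lemma SL_mapM (g h : SL n R) : SL_map (g * h)%g = (SL_map g * SL_map h)%g.
Proof. by apply/val_inj; exact: map_mxM. Qed.

Lemma SL_map1 : SL_map 1%g = 1%g.
Proof. by apply/val_inj; exact: map_mx1. Qed.

End SLmap.

Section Quotient.
Variable R : realType.

Definition SLZ : set (SL 2 R) := range (@SL_map 2 int R intr).

Definition SLZ_orbit (g h : SL 2 R) : bool :=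
  `[< exists2 c : SL 2 R, SLZ c & h = (g * c)%g >].

Lemma SLZ_orbit_refl : reflexive SLZ_orbit.
Proof.
move=> g; apply/asboolP; exists 1%g; last by rewrite mulg1.
by exists 1%g => //; exact: SL_map1.
Qed.

Lemma SLZ_orbit_sym : symmetric SLZ_orbit.
Proof.
suff H g h : SLZ_orbit g h -> SLZ_orbit h g by move=> g h; apply/idP/idP; exact: H.
move=> /asboolP[_ [c _ <-] ->]; apply/asboolP.
exists (SL_map intr c^-1)%g; first by exists c^-1%g.
by rewrite -mulgA -SL_mapM mulgV SL_map1 mulg1.
Qed.

Lemma SLZ_orbit_trans : transitive SLZ_orbit.
Proof.
move=> h g k /asboolP[_ [c _ <-] ->] /asboolP[_ [d _ <-] ->]; apply/asboolP.
exists (SL_map intr (c * d)%g); first by exists (c * d)%g.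
by rewrite SL_mapM mulgA.
Qed.

Canonical SLZ_equiv :=
  EquivRel SLZ_orbit SLZ_orbit_refl SLZ_orbit_sym SLZ_orbit_trans.

Definition SLquo : Type := {eq_quot SLZ_equiv}%qT.

Definition SLpi (g : SL 2 R) : SLquo := \pi_({eq_quot SLZ_equiv}%qT)%qT g.

End Quotient.

Definition boundary (T : topologicalType) (A : set T) : set T :=
  closure A `\` A°.

(* The boundary of F is taken in the whole group: its fibres under the
   projection are finite even counting the boundary points outside F. *)
Definition fundamental_set (R : realType) (F : set (SL 2 R)) : Prop :=
  [/\ set_surj F setT (@SLpi R),
      set_inj F° (@SLpi R) &
      forall x : SLquo R,
        finite_set (boundary F `&` (@SLpi R) @^-1` [set x])].

Section Iwasawa.
Variable R : realType.

Definition mx2 (a b c d : R) : 'M[R]_2 :=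
  \matrix_(i, j) if i == 0 then (if j == 0 then a else b)
                 else (if j == 0 then c else d).

Lemma det_mx2 a b c d : \det (mx2 a b c d) = a * d - b * c.
Proof.
rewrite (expand_det_row _ ord0) big_ord_recl big_ord1 /cofactor !det_mx11 !mxE /=.
by rewrite expr0 expr1 mul1r mulN1r mulrN.
Qed.

Fact rot_subproof (t : R) : \det (mx2 (cos t) (- sin t) (sin t) (cos t)) == 1.
Proof. by rewrite det_mx2 mulNr opprK -!expr2 cos2Dsin2. Qed.

Fact unip_subproof (T : R) : \det (mx2 1 T 0 1) == 1.
Proof. by rewrite det_mx2 mulr0 mulr1 subr0. Qed.

Fact diagpos_subproof (a : {posnum R}) :
  \det (mx2 a%:num 0 0 a%:num^-1) == 1.
Proof. by rewrite det_mx2 mulr0 subr0 divff. Qed.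

Definition rot (t : R) : SL 2 R := mkSL (rot_subproof t).
Definition unip (T : R) : SL 2 R := mkSL (unip_subproof T).
Definition diagpos (a : {posnum R}) : SL 2 R := mkSL (diagpos_subproof a).

Definition cot (x : R) : R := cos x / sin x.

Definition KNA_region (e : R) : set (SL 2 R) :=
  [set g | exists (t T : R) (a : {posnum R}),
    [/\ - e < t < e, `|T| <= cot (e + `|t|) &
        g = (rot t * unip T * diagpos a)%g]].

End Iwasawa.

(* Main.v *)
Require Import Defs.
From mathcomp Require Import all_boot all_order all_algebra.
From mathcomp Require Import all_classical all_reals all_analysis.
From mathcomp Require Import zify ring lra.

Set Implicit Arguments.
Unset Strict Implicit.

Import Order.TTheory GRing.Theory Num.Theory numFieldNormedType.Exports.
Local Open Scope classical_set_scope.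
Local Open Scope ring_scope.

(** The columns of [k_t n(T) a] are [v1 = a (cos t, sin t)] and a vector [v2] whose
angle with [v1] has cotangent [T]; so surjectivity asks for a basis [(v1, v2)] of
the lattice [h Z^2] with [v1] in the open cone of half-angle [e] about the
horizontal axis and [|T| <= c := cot (e + |t|)].  Let [v1] be a shortest lattice
vector in the cone; it is primitive.  The admissible [v2] form one class modulo
[v1], and [T] ranges over a class modulo [a^2].  If none satisfies [|T| <= c],
then some [T] has [c < T < a^2 - c]; then [v2] or [v1 - v2] lies in the cone, and
it is shorter than [v1] because [e + |t| < pi / 3] gives [3 c^2 >= 1].

The region lies in the closed set [|v1|^2 |v2|^2 <= cot(e)^2 + 1], which meets each
orbit in a finite set, the lattice vectors being bounded away from [0].  Hence any
section of [pi] with values in the region has a range [F] as required: [pi] is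
injective on all of [F], and the boundary of [F] lies in that closed set. *)

(** * Integers in a box *)

Lemma int_box (N : nat) (z : int) :
  (`|z| <= N)%N -> exists i : 'I_N.*2.+1, z = i%:Z - N%:Z.
Proof.
move=> zN; have h : (absz (z + N%:Z)%R < N.*2.+1)%N by lia.
by exists (Ordinal h) => /=; lia.
Qed.

(** An integer satisfies |z| <= z^2, so [B] already bounds |z| and no square root is taken. *)
Lemma sqr_int_bound (R : realType) (B : R) (z : int) :
  (z%:~R : R) ^+ 2 <= B -> (`|z| <= Num.bound B)%N.
Proof.
move=> zB; have B0 : 0 <= B by apply: le_trans zB; exact: sqr_ge0.
have : (`|z|%N%:R : R) <= B.
  apply: le_trans zB; rewrite -rmorphXn /= -[X in X%:R <= _]/(`|z|%N) pmulrn ler_int.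
  rewrite expr2; nia.
move=> /le_lt_trans /(_ (archi_boundP B0)); rewrite ltr_nat; exact: ltnW.
Qed.

(** * The cone about the horizontal axis *)

(** The condition |y| / x < tan e without division; where sin e and cos e are positive it forces x >
    0. *)
Definition cone (R : realType) (e x y : R) : bool := `|y| * cos e < x * sin e.

Lemma polar (R : realType) (x y : R) : 0 < x -> exists (a : {posnum R}) (t : R),
  [/\ - (pi / 2) < t < pi / 2, x = a%:num * cos t & y = a%:num * sin t].
Proof.
move=> x0; have c0 : 0 < cos (atan (y / x)).
  by apply: cos_gt0_pihalf; rewrite atan_gtNpi2 atan_ltpi2.
have a0 : 0 < x / cos (atan (y / x)) by exact: divr_gt0.
exists (PosNum a0), (atan (y / x)); split => /=.
- by rewrite atan_gtNpi2 atan_ltpi2.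
- by rewrite divfK ?gt_eqF.
- have /(_ R (y/x)) := atanK; rewrite /tan => h.
  by rewrite mulrAC -mulrA h mulrC divfK ?gt_eqF.
Qed.

Lemma sine_gt0 (R : realType) (e : R) (e_gt0 : 0 < e) (e_lt : e < pi / 6) : 0 < sin e.
Proof. by apply: sin_gt0_pi; lra. Qed.

Lemma cose_gt0 (R : realType) (e : R) (e_gt0 : 0 < e) (e_lt : e < pi / 6) : 0 < cos e.
Proof. by apply: cos_gt0_pihalf; lra. Qed.

Lemma cone_gt0 (R : realType) (e : R) (e_gt0 : 0 < e) (e_lt : e < pi / 6)
    (x y : R) : cone e x y -> 0 < x.
Proof.
rewrite /cone => h; rewrite -(pmulr_lgt0 _ (sine_gt0 e_gt0 e_lt)).
by apply: le_lt_trans h; rewrite mulr_ge0 // ltW // (cose_gt0 e_gt0 e_lt).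
Qed.

(** The cone condition reads sin (t - e) < 0 < sin (t + e); for t outside (-e, e) one of these signs
    fails. *)
Lemma cone_angle (R : realType) (e : R) (e_gt0 : 0 < e) (e_lt : e < pi / 6)
    (a : {posnum R}) (t : R) : - (pi / 2) < t < pi / 2 ->
  cone e (a%:num * cos t) (a%:num * sin t) -> - e < t < e.
Proof.
move=> /andP[t1 t2]; rewrite /cone normrM gtr0_norm // -!mulrA ltr_pM2l // => h.
have /andP[h1 h2] : - (cos t * sin e) < sin t * cos e < cos t * sin e.
  by rewrite -ltr_norml normrM (gtr0_norm (cose_gt0 e_gt0 e_lt)).
apply/andP; split; rewrite ltNge; apply/negP => te.
- have : sin (- (t + e)) >= 0 by apply: sin_ge0_pi; lra.
  by rewrite sinN sinD; lra.
- have : sin (t - e) >= 0 by apply: sin_ge0_pi; lra.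
  by rewrite sinB; lra.
Qed.

(** Since 3x < pi, the formula sin 3x = sin x (3 cos^2 x - sin^2 x) makes the last factor
    positive. *)
Lemma sin3_gt0 (R : realType) (x : R) : 0 < x < pi / 3 ->
  [/\ 0 < sin x, 0 < cos x & (sin x) ^+ 2 <= 3 * (cos x) ^+ 2].
Proof.
move=> /andP[x0 x3].
have s0 : 0 < sin x by apply: sin_gt0_pi; lra.
have c0 : 0 < cos x by apply: cos_gt0_pihalf; lra.
split => //.
have : 0 < sin (x + (x + x)) by apply: sin_gt0_pi; lra.
rewrite sinD sinD cosD.
have -> : sin x * (cos x * cos x - sin x * sin x) +
  cos x * (sin x * cos x + cos x * sin x) =
  sin x * (3 * cos x ^+ 2 - sin x ^+ 2) by ring.
by rewrite pmulr_rgt0 // => h; lra.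
Qed.

(* The point is (U, -1) in the frame whose first axis has angle t; the case of a
   negative angle follows by reflection in the axis. *)
Lemma cone_shift (R : realType) (e : R) (e_gt0 : 0 < e) (e_lt : e < pi / 6)
    (t U : R) : 0 <= t < e -> cot (e + t) < U ->
  cone e (cos t * U + sin t) (sin t * U - cos t).
Proof.
move=> /andP[t0 te]; rewrite /cot /cone => cU.
have [s0 c0 _] : [/\ 0 < sin (e + t), 0 < cos (e + t) & sin (e + t) ^+ 2 <= 3 * cos (e + t) ^+ 2].
  by apply: sin3_gt0; lra.
have U0 : 0 < U by apply: lt_trans cU; exact: divr_gt0.
move: cU; rewrite ltr_pdivrMr // => cU.
have s1 : 0 < sin (e - t) by apply: sin_gt0_pi; lra.
have c1 : 0 < cos (e - t) by apply: cos_gt0_pihalf; lra.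
(* [cU] is one half of the cone condition, cos (e + t) < U sin (e + t); this is the other half. *)
have k1 : 0 < U * sin (e - t) + cos (e - t) by apply: addr_gt0 => //; exact: mulr_gt0.
rewrite -{1}(gtr0_norm (cose_gt0 e_gt0 e_lt)) -normrM ltr_norml.
move: cU k1; rewrite sinD cosD sinB cosB => cU k1.
by apply/andP; split; lra.
Qed.

(** U^2 < (n - c)^2 = n^2 - (2nc - c^2), and n > 2c gives 2nc - c^2 > 3c^2 >= 1. In use n = a^2, and
    both sides are squared lengths times a^2. *)
Lemma gap_sqr_lt (R : realType) (U n c : R) :
  0 < c -> 1 <= 3 * c ^+ 2 -> 2 * c < n -> c < U < n - c ->
  U ^+ 2 + 1 < n ^+ 2.
Proof. move=> c0 c3 n2 /andP[U1 U2]; nra. Qed.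

(** The bound pi / 6 gives e + t < 2e < pi / 3, the range of [sin3_gt0]. *)
Lemma cot_bound (R : realType) (e : R) (e_gt0 : 0 < e) (e_lt : e < pi / 6)
    (t : R) :
  0 <= t < e -> 0 < cot (e + t) /\ 1 <= 3 * cot (e + t) ^+ 2.
Proof.
move=> /andP[t0 te].
have [s0 c0 h] : [/\ 0 < sin (e + t), 0 < cos (e + t) & sin (e + t) ^+ 2 <= 3 * cos (e + t) ^+ 2].
  by apply: sin3_gt0; lra.
split; first exact: divr_gt0.
by rewrite /cot expr_div_n mulrA ler_pdivlMr ?exprn_gt0 // mul1r.
Qed.

Lemma shift_cases (R : realType) (n c T : R) : 0 < n -> 0 < c -> exists k : int,
  `|T + k%:~R * n| <= c \/ 2 * c < n /\ c < T + k%:~R * n < n - c.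
Proof.
(* T + kn <= 0 < T + (k + 1)n are the translates next to 0. If neither lies in [-c, c], they
   straddle it, so 2c < n and the upper one lies in (c, n - c). *)
move=> n0 c0; pose k := Num.floor (- T / n).
have /andP[k1 k2] := floor_itv (- T / n).
rewrite -/k ler_pdivlMr // ltr_pdivrMr // intrD in k1 k2.
set s : R := k%:~R * n in k1.
have k2' : - T < s + n by apply: lt_le_trans k2 _; rewrite mulrDl mul1r.
have [Uc|cU] := lerP (T + s + n) c.
  by exists (k + 1); left; rewrite intrD mulrDl mul1r -/s ler_norml; lra.
have [Vc|cV] := lerP (- c) (T + s).
  by exists k; left; rewrite -/s ler_norml; lra.
by exists (k + 1); right; rewrite intrD [(k%:~R + _) * _]mulrDl mul1r -/s; split; lra.
Qed.

Lemma cauchy_schwarz2 (R : realDomainType) (a b x y : R) :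
  (a * x - b * y) ^+ 2 <= (a ^+ 2 + b ^+ 2) * (x ^+ 2 + y ^+ 2).
Proof. by have := sqr_ge0 (a * y + b * x); rewrite -subr_ge0; lra. Qed.

(** * Lattice vectors and a shortest one in the cone *)

(** [latx] and [laty] are the two coordinates of the lattice vector h (m, n)^T. *)
Definition latx (R : realType) (h : 'M[R]_2) (m n : int) : R := h 0 0 * m%:~R + h 0 1 * n%:~R.
Definition laty (R : realType) (h : 'M[R]_2) (m n : int) : R := h 1 0 * m%:~R + h 1 1 * n%:~R.
Definition latnorm (R : realType) (h : 'M[R]_2) (m n : int) : R :=
  latx h m n ^+ 2 + laty h m n ^+ 2.
Definition sqnorm (R : realType) (h : 'M[R]_2) : R :=
  h 0 0 ^+ 2 + h 0 1 ^+ 2 + h 1 0 ^+ 2 + h 1 1 ^+ 2.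

Lemma sqnorm_ge0 (R : realType) (h : 'M[R]_2) : 0 <= sqnorm h.
Proof. by rewrite /sqnorm !addr_ge0 ?sqr_ge0. Qed.

(** Cramer's rule with determinant 1 recovers m and n from the vector, and Cauchy-Schwarz bounds
    them. So only finitely many lattice vectors have bounded length. *)
Lemma lat_coord_bound (R : realType) (h : 'M[R]_2) (m n : int) :
  h 0 0 * h 1 1 - h 0 1 * h 1 0 = 1 ->
  (m%:~R : R) ^+ 2 <= sqnorm h * latnorm h m n /\
  (n%:~R : R) ^+ 2 <= sqnorm h * latnorm h m n.
Proof.
move=> d.
have N0 : 0 <= latnorm h m n by rewrite addr_ge0 ?sqr_ge0.
have em : m%:~R = h 1 1 * latx h m n - h 0 1 * laty h m n.
  rewrite /latx /laty; transitivity ((h 0 0 * h 1 1 - h 0 1 * h 1 0) * m%:~R); last by ring.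
  by rewrite d mul1r.
have en : n%:~R = h 0 0 * laty h m n - h 1 0 * latx h m n.
  rewrite /latx /laty; transitivity ((h 0 0 * h 1 1 - h 0 1 * h 1 0) * n%:~R); last by ring.
  by rewrite d mul1r.
split.
- rewrite {1}em; apply: le_trans (cauchy_schwarz2 _ _ _ _) _.
  apply: ler_wpM2r => //; rewrite /sqnorm.
  by have := sqr_ge0 (h 0 0); have := sqr_ge0 (h 1 0); lra.
- rewrite {1}en; apply: le_trans (cauchy_schwarz2 _ _ _ _) _.
  rewrite [X in _ * X]addrC; apply: ler_wpM2r => //; rewrite /sqnorm.
  by have := sqr_ge0 (h 0 1); have := sqr_ge0 (h 1 1); lra.
Qed.

(** The coordinates of h^-1 (N, 0) are rounded down; this moves the point (N, 0) by at most [D] in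
    each direction. *)
Lemma cone_lattice_point (R : realType) (e : R) (h : 'M[R]_2) :
  0 < e -> e < pi / 6 -> h 0 0 * h 1 1 - h 0 1 * h 1 0 = 1 ->
  exists m n : int, cone e (latx h m n) (laty h m n).
Proof.
move=> e_gt0 e_lt d; have s0 := sine_gt0 e_gt0 e_lt; have c0 := cose_gt0 e_gt0 e_lt.
pose D := `|h 0 0| + `|h 0 1| + `|h 1 0| + `|h 1 1|.
have D0 : 0 <= D by rewrite !addr_ge0.
(* Chosen so that x sin e >= D + 1 while |y| cos e <= D. *)
pose N := (2 * D + 1) / sin e.
have /andP[m1 m2] := floor_itv (N * h 1 1).
have /andP[n1 n2] := floor_itv (- (N * h 1 0)).
set m := Num.floor _ in m1 m2; set n := Num.floor _ in n1 n2.
rewrite intrD in m2; rewrite intrD in n2.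
pose f := N * h 1 1 - m%:~R; pose g := - (N * h 1 0) - n%:~R.
have f01 : `|f| <= 1 by rewrite ger0_norm /f; lra.
have g01 : `|g| <= 1 by rewrite ger0_norm /g; lra.
have ex : latx h m n = N - (h 0 0 * f + h 0 1 * g).
  rewrite -[N in RHS]mul1r -d /latx /f /g; ring.
have ey : laty h m n = - (h 1 0 * f + h 1 1 * g).
  rewrite /laty /f /g; ring.
have P a b : `|a * f + b * g| <= `|a| + `|b|.
  apply: le_trans (ler_normD _ _) _.
  by rewrite !normrM lerD // ler_piMr.
exists m, n; rewrite /cone ex ey normrN.
have yD : `|h 1 0 * f + h 1 1 * g| <= D.
  apply: le_trans (P _ _) _; rewrite /D.
  by have := normr_ge0 (h 0 0); have := normr_ge0 (h 0 1); lra.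
have xD : h 0 0 * f + h 0 1 * g <= D.
  apply: le_trans (ler_norm _) _; apply: le_trans (P _ _) _; rewrite /D.
  by have := normr_ge0 (h 1 0); have := normr_ge0 (h 1 1); lra.
have h1 : `|h 1 0 * f + h 1 1 * g| * cos e <= D.
  by apply: le_trans yD; rewrite ler_piMr // cos_le1.
apply: le_lt_trans h1 _.
rewrite mulrBl divfK ?gt_eqF //.
have : (h 0 0 * f + h 0 1 * g) * sin e <= D.
  by apply: le_trans (ler_wpM2r (ltW s0) xD) _; rewrite ler_piMr // sin_le1.
lra.
Qed.

(** Vectors no longer than one fixed cone vector have coordinates in a finite box. The minimum is
    taken over the cone vectors of that box; longer vectors lose to the fixed one. *)
Lemma cone_shortest_vector (R : realType) (e : R) (h : 'M[R]_2) :
  0 < e -> e < pi / 6 -> h 0 0 * h 1 1 - h 0 1 * h 1 0 = 1 ->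
  exists m n : int, cone e (latx h m n) (laty h m n) /\
    forall m' n', cone e (latx h m' n') (laty h m' n') ->
      latnorm h m n <= latnorm h m' n'.
Proof.
move=> e_gt0 e_lt d; have [m0 [n0 c0]] := cone_lattice_point e_gt0 e_lt d.
pose N := Num.bound (sqnorm h * latnorm h m0 n0).
pose b (i : 'I_N.*2.+1) := i%:Z - N%:Z.
have box m n : latnorm h m n <= latnorm h m0 n0 ->
    exists i j, m = b i /\ n = b j.
  move=> le0; have [mB nB] := lat_coord_bound m n d.
  have le1 := ler_wpM2l (sqnorm_ge0 h) le0.
  have [i ->] := int_box (sqr_int_bound (le_trans mB le1)).
  by have [j ->] := int_box (sqr_int_bound (le_trans nB le1)); exists i, j.
have [i0 [j0 [im jn]]] := box _ _ (lexx _).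
pose P (k : 'I_N.*2.+1 * 'I_N.*2.+1) :=
  cone e (latx h (b k.1) (b k.2)) (laty h (b k.1) (b k.2)).
pose f (k : 'I_N.*2.+1 * 'I_N.*2.+1) := latnorm h (b k.1) (b k.2).
have Pk0 : P (i0, j0) by rewrite /P /= -im -jn.
case: (arg_minP f Pk0) => k Pk kmin; exists (b k.1), (b k.2); split => // m n cmn.
have [le0|/ltW ge0] := lerP (latnorm h m n) (latnorm h m0 n0).
  have [i [j [ei ej]]] := box _ _ le0.
  by rewrite ei ej; apply: (kmin (i, j)); rewrite /P /= -ei -ej.
by apply: le_trans ge0; rewrite im jn; exact: (kmin (i0, j0)).
Qed.

Lemma latxZ (R : realType) (h : 'M[R]_2) (d m n : int) :
  latx h (m * d) (n * d) = d%:~R * latx h m n.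
Proof. by rewrite /latx !intrM; ring. Qed.

Lemma latyZ (R : realType) (h : 'M[R]_2) (d m n : int) :
  laty h (m * d) (n * d) = d%:~R * laty h m n.
Proof. by rewrite /laty !intrM; ring. Qed.

Lemma cone_scale (R : realType) (e k x y : R) :
  0 < k -> cone e (k * x) (k * y) = cone e x y.
Proof. by move=> k0; rewrite /cone normrM gtr0_norm // -!mulrA ltr_pM2l. Qed.

(** Division by the gcd d stays in the cone, so minimality forces d^2 <= 1. *)
Lemma shortest_coprime (R : realType) (e : R) (h : 'M[R]_2) (m n : int) :
  0 < e -> e < pi / 6 -> cone e (latx h m n) (laty h m n) ->
  (forall m' n', cone e (latx h m' n') (laty h m' n') ->
      latnorm h m n <= latnorm h m' n') ->
  gcdz m n = 1.
Proof.
move=> e_gt0 e_lt cmn min; set d := gcdz m n.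
have x0 := cone_gt0 e_gt0 e_lt cmn.
have d0 : 0 < d.
  rewrite lt_neqAle eq_sym gcdz_eq0 /d; apply/andP; split; last by [].
  apply/negP => /andP[/eqP m0 /eqP n0].
  by move: x0; rewrite m0 n0 /latx !mulr0 addr0 ltxx.
have [m' em] := dvdzP (dvdz_gcdl m n); have [n' en] := dvdzP (dvdz_gcdr m n).
rewrite -/d in em en.
have dR : (0 : R) < d%:~R by rewrite ltr0z.
have cmn' : cone e (latx h m' n') (laty h m' n').
  by move: cmn; rewrite em en latxZ latyZ cone_scale.
have x'0 := cone_gt0 e_gt0 e_lt cmn'.
have := min _ _ cmn'; rewrite em en /latnorm latxZ latyZ !exprMn -mulrDr.
have N0 : 0 < latx h m' n' ^+ 2 + laty h m' n' ^+ 2.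
  by apply: ltr_wpDr; [exact: sqr_ge0 | exact: exprn_gt0].
rewrite -[leRHS]mul1r ler_pM2r // expr_le1 // ?(ltW dR) // lerz1 => d1.
by apply/eqP; rewrite eq_le d1 /= -gtz0_ge1.
Qed.

(** * A lattice basis in the region *)

(** The four equations are the entries of h c = k_t n(T) a, where c has columns (m, n) and (u,
    v). *)
Lemma region_basis (R : realType) (e : R) (h : 'M[R]_2) :
  0 < e -> e < pi / 6 -> h 0 0 * h 1 1 - h 0 1 * h 1 0 = 1 ->
  exists m n u v : int, m * v - u * n = 1 /\
  exists (t T : R) (a : {posnum R}), - e < t < e /\ `|T| <= cot (e + `|t|) /\
   [/\ latx h m n = a%:num * cos t, laty h m n = a%:num * sin t,
       latx h u v = (cos t * T - sin t) / a%:num &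
       laty h u v = (sin t * T + cos t) / a%:num].
Proof.
move=> e_gt0 e_lt d.
have [m [n [cmn min]]] := cone_shortest_vector e_gt0 e_lt d.
have [v [u' uv]] := Bezoutz m n.
rewrite (shortest_coprime e_gt0 e_lt cmn min) in uv.
pose u := - u'; have {}uv : m * v - u * n = 1 by rewrite -uv /u; ring.
have [a [t [tpi ex ey]]] := polar (laty h m n) (cone_gt0 e_gt0 e_lt cmn).
have te : - e < t < e.
  by apply: (cone_angle (a := a) e_gt0 e_lt tpi); rewrite -ex -ey.
have te' : 0 <= `|t| < e by rewrite normr_ge0 ltr_norml.
have [c0 c3] := cot_bound e_gt0 e_lt te'.
set c := cot _ in c0 c3.
have a0 : 0 < a%:num by [].
have an0 : a%:num != 0 by rewrite gt_eqF.
have a20 : 0 < a%:num ^+ 2 by rewrite exprn_gt0.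
have cs : cos t ^+ 2 + sin t ^+ 2 = 1 by exact: cos2Dsin2.
have detmn : latx h m n * laty h u v - laty h m n * latx h u v = 1.
  transitivity ((h 0 0 * h 1 1 - h 0 1 * h 1 0) * (m * v - u * n)%:~R).
    by rewrite /latx /laty intrB !intrM; ring.
  by rewrite d uv mul1r.
(* The parameter T is the inner product of v1 and v2, so adding k v1 to v2 adds k a^2 to it. *)
pose T0 := latx h m n * latx h u v + laty h m n * laty h u v.
have [k Hk] := shift_cases T0 a20 c0.
set T := T0 + _ in Hk.
pose u2 := u + k * m; pose v2 := v + k * n.
have eZ : latx h u2 v2 = latx h u v + k%:~R * latx h m n.
  by rewrite /latx /u2 /v2 !intrD !intrM; ring.
have eW : laty h u2 v2 = laty h u v + k%:~R * laty h m n.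
  by rewrite /laty /u2 /v2 !intrD !intrM; ring.
(* Multiplying by the determinant makes both sides homogeneous, so that only cos^2 + sin^2 = 1 is
   left to use. *)
have unit1 x : x = x * (a%:num * (cos t * laty h u v - sin t * latx h u v)).
  by rewrite mulrBr !mulrA -ex -ey detmn mulr1.
have eZ' : latx h u2 v2 = (cos t * T - sin t) / a%:num.
  apply: (mulIf an0); rewrite divfK // eZ /T /T0 [X in _ - X]unit1 ex ey.
  set z := latx h u v; set w := laty h u v.
  transitivity ((cos t ^+ 2 + sin t ^+ 2) * z * a%:num + k%:~R * cos t * a%:num ^+ 2);
    last by ring.
  by rewrite cs; ring.
have eW' : laty h u2 v2 = (sin t * T + cos t) / a%:num.
  apply: (mulIf an0); rewrite divfK // eW /T /T0 [cos t in RHS]unit1 ex ey.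
  set z := latx h u v; set w := laty h u v.
  transitivity ((cos t ^+ 2 + sin t ^+ 2) * w * a%:num + k%:~R * sin t * a%:num ^+ 2);
    last by ring.
  by rewrite cs; ring.
have uv2 : m * v2 - u2 * n = 1 by rewrite -uv /u2 /v2; ring.
case: Hk => [Tc|[ac Tg]].
  by exists m, n, u2, v2; split => //; exists t, T, a.
have Nmn : latnorm h m n = a%:num ^+ 2.
  by rewrite /latnorm ex ey !exprMn -mulrDr cs mulr1.
(* Up to reflection in the horizontal axis, a times this vector is (U, -1) in the frame at angle
   |t|. It lies in the cone, and U^2 + 1 < a^4 makes it shorter than v1. *)
have absurd (m' n' : int) (U y : R) : c < U < a%:num ^+ 2 - c ->
    a%:num * latx h m' n' = cos t * U + `|sin t| ->
    a%:num * laty h m' n' = y -> `|y| = `| `|sin t| * U - cos t| -> False.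
  move=> Uc e1 e2 ey'.
  have st : `|sin t| = sin `|t|.
    have [t0|t0] := ger0P t.
      by rewrite ger0_norm //; apply: sin_ge0_pi; lra.
    by rewrite sinN ltr0_norm // -oppr_gt0 -sinN; apply: sin_gt0_pi; lra.
  have ct : cos t = cos `|t| by rewrite cos_norm.
  have : cone e (latx h m' n') (laty h m' n').
    rewrite -(cone_scale _ _ _ a0) e1 e2 /cone ey' st ct.
    by apply: cone_shift => //; case/andP: Uc.
  move=> /min; rewrite Nmn -(ler_pM2l a20) leNgt => /negP; apply.
  rewrite /latnorm mulrDr -!exprMn e1 e2 -[y ^+ 2]real_normK ?num_real // ey'.
  rewrite real_normK ?num_real //.
  have -> : (cos t * U + `|sin t|) ^+ 2 + (`|sin t| * U - cos t) ^+ 2 =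
      (cos t ^+ 2 + `|sin t| ^+ 2) * (U ^+ 2 + 1) by ring.
  rewrite real_normK ?num_real // cs mul1r -expr2.
  exact: gap_sqr_lt c0 c3 ac Uc.
(* In the frame of v1, a v2 is (T, 1) and a (v1 - v2) is (a^2 - T, -1). The first serves for t <= 0
   after reflection, the second for t > 0; T -> a^2 - T preserves the gap. *)
exfalso; have [t0|t0] := lerP t 0.
- have st : sin t <= 0.
    by rewrite -oppr_ge0 -sinN; apply: sin_ge0_pi; lra.
  apply: (absurd u2 v2 T (sin t * T + cos t)) => //.
  + by rewrite eZ' mulrC divfK // ler0_norm.
  + by rewrite eW' mulrC divfK.
  + by rewrite (ler0_norm st) -normrN; congr `| _ |; ring.
- have st : 0 <= sin t by apply: sin_ge0_pi; lra.
  apply: (absurd (m - u2) (n - v2) (a%:num ^+ 2 - T)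
            (sin t * (a%:num ^+ 2 - T) - cos t)).
  + by lra.
  + have -> : latx h (m - u2) (n - v2) = latx h m n - latx h u2 v2.
      by rewrite /latx !intrB; ring.
    rewrite ex eZ' ger0_norm // mulrBr [a%:num * (_ / _)]mulrC divfK //; ring.
  + have -> : laty h (m - u2) (n - v2) = laty h m n - laty h u2 v2.
      by rewrite /laty !intrB; ring.
    by rewrite ey eW' mulrBr [a%:num * (_ / _)]mulrC divfK //; ring.
  + by rewrite (ger0_norm st).
Qed.

(** * Two-by-two matrices and surjectivity *)

Lemma mulmx2E (R : comNzRingType) (A B : 'M[R]_2) (i j : 'I_2) :
  (A *m B) i j = A i 0 * B 0 j + A i 1 * B 1 j.
Proof.
rewrite mxE big_ord_recl big_ord1; congr (_ + A i _ * B _ j); exact: val_inj.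
Qed.

Lemma det2E (R : comNzRingType) (A : 'M[R]_2) :
  \det A = A 0 0 * A 1 1 - A 0 1 * A 1 0.
Proof.
rewrite (expand_det_row _ ord0) big_ord_recl big_ord1 /cofactor !det_mx11 !mxE /=.
rewrite expr0 expr1 mul1r mulN1r mulrN.
by congr (A _ _ * A _ _ - A _ _ * A _ _); exact: val_inj.
Qed.

Lemma ord2P (P : 'I_2 -> Prop) : P 0 -> P 1 -> forall i, P i.
Proof.
move=> P0 P1 [[|[|//]] i2].
- by rewrite (_ : Ordinal i2 = 0) //; exact: val_inj.
- by rewrite (_ : Ordinal i2 = 1) //; exact: val_inj.
Qed.

Lemma mx2P (R : Type) (A B : 'M[R]_2) : A 0 0 = B 0 0 -> A 0 1 = B 0 1 ->
  A 1 0 = B 1 0 -> A 1 1 = B 1 1 -> A = B.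
Proof.
move=> *; apply/matrixP => i j.
by move: i j; apply: ord2P; apply: ord2P.
Qed.

Lemma SL_detE (R : realType) (h : SL 2 R) :
  h 0 0 * h 1 1 - h 0 1 * h 1 0 = 1.
Proof. by rewrite -det2E; exact/eqP/SL_det. Qed.

Lemma SLpi_eq (R : realType) (g h : SL 2 R) :
  SLpi g = SLpi h <-> exists c : SL 2 int, h = (g * SL_map intr c)%g.
Proof.
split.
- by move=> /eqmodP /asboolP[_ [c _ <-] ->]; exists c.
- by move=> [c ->]; apply/eqmodP/asboolP; exists (SL_map intr c) => //; exists c.
Qed.

Lemma region_surj (R : realType) (e : R) (h : SL 2 R) :
  0 < e -> e < pi / 6 -> exists g, KNA_region e g /\ SLpi g = SLpi h.
Proof.
move=> e_gt0 e_lt.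
have [m [n [u [v [uv [t [T [a [te [Tc [ex ey ez ew]]]]]]]]]]] :=
  region_basis e_gt0 e_lt (SL_detE h).
pose c : 'M[int]_2 :=
  \matrix_(i, j) if i == 0 then (if j == 0 then m else u)
                 else (if j == 0 then n else v).
have dc : \det c == 1 by rewrite det2E !mxE /= uv.
exists (h * SL_map intr (mkSL dc))%g; split; last first.
  by apply/esym/SLpi_eq; exists (mkSL dc).
exists t, T, a; split => //.
have an0 : a%:num != 0 by rewrite gt_eqF.
apply/val_inj => /=; apply: mx2P;
  rewrite !mulmx2E !mxE /= -/(latx h m n) -/(laty h m n) -/(latx h u v) -/(laty h u v)
    ?ex ?ey ?ez ?ew; by field.
Qed.

(** * Finiteness of the fibres *)

Lemma cot_le (R : realType) (e s : R) : 0 < e -> e < pi / 6 -> 0 <= s < e ->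
  cot (e + s) <= cot e.
Proof.
move=> e_gt0 e_lt /andP[s0 se].
have h1 : 0 < sin (e + s) by apply: sin_gt0_pi; lra.
have h2 : 0 <= sin (e + s - e) by apply: sin_ge0_pi; lra.
rewrite /cot ler_pdivrMr // mulrAC ler_pdivlMr ?sine_gt0 //.
by move: h2; rewrite sinB; lra.
Qed.

(** The columns have lengths a and sqrt (T^2 + 1) / a, so a cancels and the product is T^2 + 1. *)
Lemma region_norm_prod (R : realType) (e : R) (g : SL 2 R) :
  0 < e -> e < pi / 6 -> KNA_region e g ->
  latnorm g 1 0 * latnorm g 0 1 <= cot e ^+ 2 + 1.
Proof.
move=> e_gt0 e_lt [t [T [a [te Tc ->]]]].
have an0 : a%:num != 0 by rewrite gt_eqF.
have cs : cos t ^+ 2 + sin t ^+ 2 = 1 by exact: cos2Dsin2.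
rewrite /latnorm /latx /laty /= !mulmx2E !mxE /= !mulr1z !mulr0z.
rewrite [leLHS](_ : _ = (cos t ^+ 2 + sin t ^+ 2) ^+ 2 * (T ^+ 2 + 1)); last by field.
rewrite cs expr1n mul1r lerD2r -[T ^+ 2]real_normK ?num_real //.
have te' : 0 <= `|t| < e by rewrite normr_ge0 ltr_norml.
by apply: lerXn2r; rewrite ?nnegrE ?(le_trans Tc) ?cot_le // (le_trans _ (cot_le e_gt0 e_lt te')) //
  (le_trans _ Tc).
Qed.

Lemma closed_norm_prod (R : realType) (K : R) :
  closed [set g : SL 2 R | latnorm g 1 0 * latnorm g 0 1 <= K].
Proof.
have cE (i j : 'I_2) : continuous (fun g : SL 2 R => SL_mx g i j).
  move=> g; apply: (@continuous_comp _ _ _ (@SL_mx 2 R) (fun M : 'M[R]_2 => M i j)).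
    exact: initial_continuous.
  exact: coord_continuous.
have cx m n : continuous (fun g : SL 2 R => latx g m n).
  move=> g; exact: (cvgD (cvgM (cE 0 0 g) (cvg_cst _)) (cvgM (cE 0 1 g) (cvg_cst _))).
have cy m n : continuous (fun g : SL 2 R => laty g m n).
  move=> g; exact: (cvgD (cvgM (cE 1 0 g) (cvg_cst _)) (cvgM (cE 1 1 g) (cvg_cst _))).
have cN m n : continuous (fun g : SL 2 R => latnorm g m n).
  move=> g.
  exact: (cvgD (cvgM (cx m n g) (cx m n g)) (cvgM (cy m n g) (cy m n g))).
apply: (@preimage_closed _ _ (fun g : SL 2 R => latnorm g 1 0 * latnorm g 0 1) [set x | x <= K]).
  by move=> g _; exact: (cvgM (cN 1 0 g) (cN 0 1 g)).
exact: closed_le.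
Qed.

Lemma latnorm_mul (R : realType) (h : 'M[R]_2) (c : 'M[int]_2) (m n : int) :
  latnorm (h *m map_mx intr c) m n =
  latnorm h (c 0 0 * m + c 0 1 * n) (c 1 0 * m + c 1 1 * n).
Proof.
by rewrite /latnorm /latx /laty !mulmx2E !mxE !intrD !intrM; congr (_ ^+ 2 + _ ^+ 2); ring.
Qed.

Lemma latnorm_lower (R : realType) (h : 'M[R]_2) (m n : int) :
  h 0 0 * h 1 1 - h 0 1 * h 1 0 = 1 -> (m, n) != (0, 0) ->
  1 <= sqnorm h * latnorm h m n.
Proof.
move=> d mn; have [hm hn] := lat_coord_bound m n d.
have sq1 (z : int) : z != 0 -> (1 : R) <= z%:~R ^+ 2.
  by move=> z0; rewrite -rmorphXn /= ler1z; lia.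
have [m0|m0] := eqVneq m 0; last exact: le_trans (sq1 _ m0) hm.
have [n0|n0] := eqVneq n 0; last exact: le_trans (sq1 _ n0) hn.
by move: mn; rewrite m0 n0 eqxx.
Qed.

(** Write g = h c. For each column of c, S times the squared length of its image is at least 1, and
    the product of the two is at most S^2 K. Hence each is at most S^2 K, which bounds the entries
    of c. *)
Lemma finite_fibre (R : realType) (K : R) (h : SL 2 R) :
  finite_set [set g : SL 2 R |
    latnorm g 1 0 * latnorm g 0 1 <= K /\ SLpi h = SLpi g].
Proof.
set S := sqnorm h.
pose B := S ^+ 2 * K; pose N := Num.bound B.
(* Products of determinant other than 1 go to the default [SL_one]; the image only has to contain
   the fibre. *)
pose f (M : 'M['I_N.*2.+1]_2) : SL 2 R :=
  insubd (SL_one 2 R) (SL_mx h *m map_mx intr (map_mx (fun i : 'I_N.*2.+1 => i%:Z - N%:Z) M)).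
apply: (@sub_finite_set _ _ (f @` setT)); last exact/finite_image/finite_finset.
move=> g /= [gK /SLpi_eq[c eg]].
have S0 : 0 <= S by exact: sqnorm_ge0.
have d := SL_detE h.
have N10 : latnorm g 1 0 = latnorm h (c 0 0) (c 1 0).
  by rewrite eg latnorm_mul; congr latnorm; ring.
have N01 : latnorm g 0 1 = latnorm h (c 0 1) (c 1 1).
  by rewrite eg latnorm_mul; congr latnorm; ring.
rewrite N10 N01 in gK.
have dc : c 0 0 * c 1 1 - c 0 1 * c 1 0 = 1 by rewrite -det2E; exact/eqP/SL_det.
have L1 : 1 <= S * latnorm h (c 0 0) (c 1 0).
  apply: latnorm_lower => //; apply/negP => /eqP[z1 z2].
  by move: dc; rewrite z1 z2 mul0r mulr0 subrr.
have L2 : 1 <= S * latnorm h (c 0 1) (c 1 1).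
  apply: latnorm_lower => //; apply/negP => /eqP[z1 z2].
  by move: dc; rewrite z1 z2 mul0r mulr0 subrr.
have prod_le : (S * latnorm h (c 0 0) (c 1 0)) * (S * latnorm h (c 0 1) (c 1 1)) <= B.
  rewrite mulrACA -expr2; apply: ler_wpM2l => //; exact: sqr_ge0.
have U1 : S * latnorm h (c 0 0) (c 1 0) <= B.
  by apply: le_trans prod_le; rewrite ler_peMr // (le_trans ler01).
have U2 : S * latnorm h (c 0 1) (c 1 1) <= B.
  by apply: le_trans prod_le; rewrite ler_peMl // (le_trans ler01).
have box i j : exists k : 'I_N.*2.+1, c i j = k%:Z - N%:Z.
  apply/int_box/sqr_int_bound.
  have [A1 A2] := lat_coord_bound (c 0 0) (c 1 0) d.
  have [A3 A4] := lat_coord_bound (c 0 1) (c 1 1) d.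
  by move: i j; apply: ord2P; apply: ord2P; apply: le_trans; eassumption.
have [F HF] := choice (fun ij : 'I_2 * 'I_2 => box ij.1 ij.2).
exists (\matrix_(i, j) F (i, j)) => //.
rewrite /f (_ : map_mx _ (\matrix_(i, j) F (i, j)) = SL_mx c).
  by rewrite eg -[_ *m _]/(val (h * SL_map intr c)%g) valKd.
by apply/matrixP => i j; rewrite !mxE -(HF (i, j)).
Qed.

Theorem mainTheorem6 (R : realType) (e : R) (e_gt0 : 0 < e) (e_lt : e < pi / 6) :
  exists F : set (SL 2 R), F `<=` KNA_region e /\ fundamental_set F.
Proof.
have [s Hs] := choice (fun x : SLquo R => region_surj (repr x) e_gt0 e_lt).
have piK x : SLpi (s x) = x by rewrite (Hs x).2; exact: reprK.
exists (range s); split; first by move=> _ [x _ <-]; have [] := Hs x.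
split.
- by move=> x _; exists (s x); [exists x | exact: piK].
- move=> g k; rewrite !inE => /interior_subset[x _ <-] /interior_subset[y _ <-].
  by rewrite !piK => ->.
- move=> x; apply: sub_finite_set (finite_fibre (cot e ^+ 2 + 1) (s x)).
  move=> g [[gF _] gx]; split; last by rewrite piK.
  (* Boundary points may lie outside the range of [s]; its closure still lies in the closed set. *)
  apply: (@closed_norm_prod R (cot e ^+ 2 + 1) g); apply: closureS gF => _ [y _ <-] /=.
  by apply: region_norm_prod => //; have [] := Hs y.
Qed.
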